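(* Let $E$ be a Banach space and let $\nu\colon\mathcal B_E\to[0,+\infty)$ be a set function such that (i) for all $A,B\in\mathcal B_E$, $A\subseteq B$ implies $\nu(A)\le\nu(B)$, and (ii) $\nu(\lambda A+(1-\lambda)B)\le\lambda\nu(A)+(1-\lambda)\nu(B)$ for all $A,B\in\mathcal B_E$ and all $\lambda\in[0,1]$. Then $\nu(\operatorname{conv}A)=\nu(A)$ for every non-empty relatively compact set $A\subseteq E$.
   Context: $E$ is a real or complex Banach space and $\mathcal B_E$ is the family of all non-empty bounded subsets of $E$. $\operatorname{conv}A$ is the (not necessarily closed) convex hull; $A+B=\{a+b: a\in A, b\in B\}$, $\lambda A=\{\lambda a: a\in A\}$. *)

(* Defs.v *)
From HB Require Import structures.
From mathcomp Require Import all_boot all_order all_algebra.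
From mathcomp Require Import complex.
From mathcomp Require Import all_classical all_reals all_analysis.
Set Implicit Arguments.
Unset Strict Implicit.
Unset Printing Implicit Defensive.
Import Order.TTheory GRing.Theory Num.Theory numFieldNormedType.Exports.
Local Open Scope classical_set_scope.
Local Open Scope ring_scope.

Variant scalar_kind := RealScalars | ComplexScalars.

Definition scalars (R : realType) (s : scalar_kind) : numFieldType :=
  match s with
  | RealScalars => R
  | ComplexScalars => R[i]%C
  end.

Definition of_real (R : realType) (s : scalar_kind) : R -> scalars R s :=
  match s return R -> scalars R s with
  | RealScalars => id
  | ComplexScalars => real_complex R
  end.

Definition bounded_family (K : numFieldType) (E : normedModType K) :
    set (set E) :=
  [set A | A !=set0 /\ bounded_set A].

Definition minkowski_sum (V : zmodType) (A B : set V) : set V :=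
  [set a + b | a in A & b in B].

Definition dilate (K : pzRingType) (V : lmodType K) (c : K) (A : set V) :
    set V :=
  [set c *: a | a in A].

(* No closure is taken.  Convexity only involves real coefficients, also when
   K = R[i]: an element t of K with 0 <= t <= 1 is real for the order of a
   numFieldType. *)
Definition convex_hull (K : numFieldType) (V : lmodType K) (A : set V) :
    set V :=
  smallest (@convex_set K V) A.

(* Main.v *)
Require Import Defs.
From HB Require Import structures.
From mathcomp Require Import all_boot all_order all_algebra.
From mathcomp Require Import complex.
From mathcomp Require Import all_classical all_reals all_analysis.
From mathcomp Require Import ring lra.
Set Implicit Arguments.
Unset Strict Implicit.
Unset Printing Implicit Defensive.
Import Order.TTheory GRing.Theory Num.Theory numFieldNormedType.Exports.
Local Open Scope classical_set_scope.
Local Open Scope ring_scope.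

(** The convex hull [C] of [A] reproduces itself: for a finite set of [n]
    points, each point of [C] has a coefficient at least [1/n], so [C] lies in
    [m A + (1 - m) C] with [m = 1/n], whence
    [nu C <= m nu A + (1 - m) nu C], that is, [nu C <= nu A].

    For a relatively compact [A], cover [A] by finitely many balls of radius
    [e / 2].  The same argument applied to the pieces of [A] in these balls
    (convex_hull_cover) gives [C] included in [m N + (1 - m) C] for some
    [m > 0], where [N] is any bounded set containing the closed
    [e]-neighbourhood of [A]: the hull of a piece stays in its ball, hence
    within [e] of [A].  So [nu C <= nu N], however small [m] is.

    It remains to compare [nu N] with [nu A].  With [B] the closed unit ball,
    [a + e b = (1 - e) a + e (a + b)] shows that one may take
    [N = e (A + B) + (1 - e) A], so that convexity of [nu] yields
    [nu C <= (1 - e) nu A + e nu (A + B)], and [e] tends to 0. *)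

(** * Convex sets and convex hulls *)

(** Restates convexity with scalars in place of the bundled elements of the
    unit interval. *)
Lemma convex_setP (K : numFieldType) (V : lmodType K) (A : set V) :
  convex_set A <->
  forall (x y : V) (t : K), A x -> A y -> 0 <= t -> t <= 1 ->
    A (t *: x + (1 - t) *: y).
Proof.
split=> [cA x y t Ax Ay t0 t1|cA x y t].
  by have := cA x y (Itv01 t0 t1); rewrite !inE; apply.
rewrite !inE => Ax Ay; apply: (cA x y t%:num) => //.
Qed.

Lemma convex_hull_convex (K : numFieldType) (V : lmodType K) (A : set V) :
  convex_set (convex_hull A).
Proof.
apply/convex_setP => x y t Ax Ay t0 t1 C [cC AC].
by move/convex_setP: (cC); apply => //; [exact: Ax|exact: Ay].
Qed.

Lemma sub_convex_hull (K : numFieldType) (V : lmodType K) (A : set V) :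
  A `<=` convex_hull A.
Proof. exact: sub_gen_smallest. Qed.

Lemma convex_hull_min (K : numFieldType) (V : lmodType K) (A C : set V) :
  convex_set C -> A `<=` C -> convex_hull A `<=` C.
Proof. exact: smallest_sub. Qed.

Lemma convex_hull_mono (K : numFieldType) (V : lmodType K) (A B : set V) :
  A `<=` B -> convex_hull A `<=` convex_hull B.
Proof.
move=> AB; apply: convex_hull_min; first exact: convex_hull_convex.
exact: subset_trans AB (@sub_convex_hull _ _ _).
Qed.

(** Lets weights add up to anything, so that convex combinations can be
    regrouped without normalising; the degenerate case [u + v = 0], where one
    cannot divide, is settled here once. *)
Lemma convex_cone_combination (K : numFieldType) (V : lmodType K) (C : set V)
    (x y : V) (u v : K) :
  convex_set C -> C x -> C y -> 0 <= u -> 0 <= v ->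
  exists2 z, C z & u *: x + v *: y = (u + v) *: z.
Proof.
move=> /convex_setP cC Cx Cy u0 v0.
have := addr_ge0 u0 v0; rewrite le_eqVlt => /predU1P[/esym uv0|uv0].
  have [/eqP -> /eqP ->] : u == 0 /\ v == 0.
    by apply/andP; rewrite -paddr_eq0// uv0.
  by exists x => //; rewrite addr0 !scale0r addr0.
have uvN0 : u + v != 0 by rewrite gt_eqF.
exists ((u / (u + v)) *: x + (1 - u / (u + v)) *: y).
  apply: cC => //; first by rewrite divr_ge0// ltW.
  by rewrite ler_pdivrMr// mul1r lerDl.
rewrite scalerDr !scalerA; congr (_ *: _ + _ *: _); first by field.
by field.
Qed.

(** The set of points of segments joining the two hulls is convex: in a
    combination of two such points, the parts lying in each hull can be
    regrouped, since that hull is convex.  It contains [A] and [B] because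
    neither is empty. *)
Lemma convex_hullU (K : numFieldType) (V : lmodType K) (A B : set V) (c : V) :
  A !=set0 -> B !=set0 -> convex_hull (A `|` B) c ->
  exists p q t, [/\ convex_hull A p, convex_hull B q, 0 <= t, t <= 1 &
    c = t *: p + (1 - t) *: q].
Proof.
move=> [a0 Aa0] [b0 Bb0].
pose J : set V := [set c | exists p q t,
  [/\ convex_hull A p, convex_hull B q, 0 <= t, t <= 1 &
      c = t *: p + (1 - t) *: q]].
apply: (@convex_hull_min _ _ _ J); last first.
  move=> x [Ax|Bx].
    exists x, b0, 1; split => //; try exact: sub_convex_hull.
    by rewrite subrr scale0r addr0 scale1r.
  exists a0, x, 0; split => //; try exact: sub_convex_hull.
  by rewrite subr0 scale0r add0r scale1r.
apply/convex_setP => x y l [p [q [t [Ap Bq t0 t1 ->]]]].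
move=> [p' [q' [t' [Ap' Bq' t0' t1' ->]]]] l0 l1.
have l1' : 0 <= 1 - l by rewrite subr_ge0.
have s0 : 0 <= 1 - t by rewrite subr_ge0.
have s0' : 0 <= 1 - t' by rewrite subr_ge0.
have [p2 Ap2 e1] := @convex_cone_combination _ _ _ p p' (l * t) ((1 - l) * t')
  (@convex_hull_convex _ _ A) Ap Ap'
  (mulr_ge0 l0 t0) (mulr_ge0 l1' t0').
have [q2 Bq2 e2] := @convex_cone_combination _ _ _ q q' (l * (1 - t))
  ((1 - l) * (1 - t'))
  (@convex_hull_convex _ _ B) Bq Bq' (mulr_ge0 l0 s0) (mulr_ge0 l1' s0').
have E : 1 - (l * t + (1 - l) * t') = l * (1 - t) + (1 - l) * (1 - t') by ring.
exists p2, q2, (l * t + (1 - l) * t'); split => //.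
- by rewrite addr_ge0// mulr_ge0.
- by rewrite -subr_ge0 E addr_ge0// mulr_ge0.
by rewrite E -e1 -e2 !scalerDr !scalerA addrACA.
Qed.

(** Part of the weight of [x] can be moved into the other point, since [x] is
    itself in [C]. *)
Lemma convex_lower_weight (K : numFieldType) (V : lmodType K) (C : set V)
    (x y : V) (m l : K) :
  convex_set C -> C x -> C y -> m <= l -> l <= 1 ->
  exists2 z, C z & l *: x + (1 - l) *: y = m *: x + (1 - m) *: z.
Proof.
move=> cC Cx Cy ml l1.
have [z Cz e] := @convex_cone_combination _ _ _ x y (l - m) (1 - l) cC Cx Cy
  ltac:(by rewrite subr_ge0) ltac:(by rewrite subr_ge0).
exists z => //; have -> : 1 - m = l - m + (1 - l) by ring.
by rewrite -e addrA -scalerDl; congr (_ *: _ + _); ring.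
Qed.

(** When finitely many pieces cover [D], a point of the hull of [D] gives at
    least one of the pieces a substantial weight.  The point of the bound is
    that it depends on the number of pieces only.  The sharp bound is the
    inverse of [size s]; [2^-1 ^+ size s] is what falls out of the induction,
    where either the new piece or all the others together have weight at least
    [2^-1]. *)
Lemma convex_hull_cover (K : numFieldType) (V : lmodType K) (I : eqType)
    (f : I -> set V) (s : seq I) (D : set V) :
  D `<=` [set x | exists2 i, i \in s & f i x] ->
  forall c, convex_hull D c -> exists i a b,
    [/\ i \in s, convex_hull (D `&` f i) a, convex_hull D b &
        c = 2^-1 ^+ size s *: a + (1 - 2^-1 ^+ size s) *: b].
Proof.
elim: s D => [|j s IH] D Dcov c Dc.
  suff : (set0 : set V) c by [].
  apply: convex_hull_min Dc; first by apply/convex_setP.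
  by move=> x /Dcov[].
have m0 : 0 <= 2^-1 ^+ size s :> K by rewrite exprn_ge0// invr_ge0.
have m1 : 2^-1 ^+ size s <= 1 :> K.
  by rewrite exprn_ile1// ?invr_ge0// invf_le1// ler1n.
(* By convex_lower_weight, any larger weight will do. *)
suff [i [a [b [l [si Da Db ml [l1 ->]]]]]] : exists i a b l,
    [/\ i \in j :: s, convex_hull (D `&` f i) a, convex_hull D b,
        2^-1 ^+ (size s).+1 <= l & l <= 1 /\ c = l *: a + (1 - l) *: b].
  have Da' : convex_hull D a by apply: convex_hull_mono Da; exact: subIsetl.
  have [z Dz e] := @convex_lower_weight _ _ _ a b _ l
    (@convex_hull_convex _ _ D) Da' Db ml l1.
  by exists i, a, z.
have h0 : 0 <= 2^-1 :> K by rewrite invr_ge0.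
have h1 : 2^-1 <= 1 :> K by rewrite invf_le1// ler1n.
pose D1 := D `&` f j; pose D2 := D `&` [set x | exists2 i, i \in s & f i x].
have DE : D = D1 `|` D2.
  apply/seteqP; split=> [x Dx|x [[]//|[]//]].
  have [i + fix_] := Dcov _ Dx; rewrite inE => /predU1P[ij|si].
    by left; split => //; rewrite -ij.
  by right; split => //; exists i.
have IH2 q : convex_hull D2 q -> exists i a b,
    [/\ i \in s, convex_hull (D `&` f i) a, convex_hull D b &
        q = 2^-1 ^+ size s *: a + (1 - 2^-1 ^+ size s) *: b].
  move=> /(IH D2 ltac:(by move=> x [])) [i [a [b [si D2a D2b ->]]]].
  exists i, a, b; split => //.
    by apply: convex_hull_mono D2a; apply: setSI; exact: subIsetl.
  by apply: convex_hull_mono D2b; exact: subIsetl.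
have [D10|/set0P D10] := eqVneq D1 set0.
  have [] := IH2 c; first by rewrite -[D2]set0U -D10 -DE.
  move=> i [a [b [si Da Db ->]]].
  exists i, a, b, (2^-1 ^+ size s); split => //.
    by rewrite inE si orbT.
  by rewrite exprS ler_piMl.
have [D20|/set0P D20] := eqVneq D2 set0.
  exists j, c, c, 1; split => //; first by rewrite mem_head.
  - by rewrite -/D1 -[D1]setU0 -D20 -DE.
  - by rewrite exprn_ile1.
  - by rewrite subrr scale0r scale1r addr0.
have /(convex_hullU D10 D20) : convex_hull (D1 `|` D2) c by rewrite -DE.
move=> [p [q [t [D1p D2q t0 t1 ->]]]].
have s0 : 0 <= 1 - t by rewrite subr_ge0.
have s1 : 1 - t <= 1 by rewrite gerBl.
have Dp : convex_hull D p by apply: convex_hull_mono D1p; exact: subIsetl.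
have [ht|th] := real_leP (ger0_real h0) (ger0_real t0).
  exists j, p, q, t; split => //; first by rewrite mem_head.
    by apply: convex_hull_mono D2q; exact: subIsetl.
  by rewrite (le_trans _ ht)// exprS ler_piMr.
have hs : 2^-1 <= 1 - t.
  rewrite lerBrDr -lerBrDl (le_trans (ltW th))//.
  by rewrite (_ : 1 - 2^-1 = 2^-1)//; field.
have [i [a [b [si Da Db ->]]]] := IH2 q D2q.
set m := 2^-1 ^+ size s in m0 m1 *.
have w0 : 0 <= (1 - t) * (1 - m) by rewrite mulr_ge0// subr_ge0.
have [z Dz e] := @convex_cone_combination _ _ _ p b _ _
  (@convex_hull_convex _ _ D) Dp Db t0 w0.
exists i, a, z, ((1 - t) * m); split => //.
- by rewrite inE si orbT.
- by rewrite exprS ler_wpM2r.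
split; first by rewrite mulr_ile1.
have -> : 1 - (1 - t) * m = t + (1 - t) * (1 - m) by ring.
by rewrite -e scalerDr !scalerA addrCA.
Qed.

(** * Bounded sets and balls *)

Lemma bounded_setP (K : numFieldType) (E : normedModType K) (A : set E) :
  bounded_set A <-> exists M : K, forall x, A x -> `|x| <= M.
Proof.
split=> [[M [Mr AM]]|[M AM]].
  by exists (M + 1); apply: AM; rewrite ltrDl.
have [->|/set0P[a Aa]] := eqVneq A set0; first by exists 0; split => // ? ? ?.
have M0 : 0 <= M by rewrite (le_trans _ (AM a Aa)).
exists M; split; first by apply: ger0_real.
by move=> x Mx y /AM /le_trans; apply; exact: ltW.
Qed.

Lemma bounded_minkowski_sum (K : numFieldType) (E : normedModType K)
    (A B : set E) :
  bounded_family A -> bounded_family B -> bounded_family (minkowski_sum A B).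
Proof.
move=> [[a Aa] /bounded_setP[M AM]] [[b Bb] /bounded_setP[N BN]].
split; first by exists (a + b), a => //; exists b.
apply/bounded_setP; exists (M + N) => _ [x Ax [y By <-]].
by rewrite (le_trans (ler_normD _ _))// lerD ?AM ?BN.
Qed.

Lemma bounded_dilate (K : numFieldType) (E : normedModType K) (k : K)
    (A : set E) :
  bounded_family A -> bounded_family (dilate k A).
Proof.
move=> [[a Aa] /bounded_setP[M AM]].
split; first by exists (k *: a), a.
apply/bounded_setP; exists (`|k| * M) => _ [x Ax <-].
by rewrite normrZ ler_wpM2l// AM.
Qed.

Lemma convex_closed_ball (K : numFieldType) (E : normedModType K) (x : E)
    (r : K) :
  convex_set [set y | `|x - y| <= r].
Proof.
apply/convex_setP => y z t /= xy xz t0 t1.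
have s0 : 0 <= 1 - t by rewrite subr_ge0.
have -> : x - (t *: y + (1 - t) *: z) = t *: (x - y) + (1 - t) *: (x - z).
  rewrite !scalerBr addrACA -scalerDl -opprD; congr (_ - _).
  by rewrite addrC subrK scale1r.
rewrite (le_trans (ler_normD _ _))// !normrZ (ger0_norm t0) (ger0_norm s0).
have -> : r = t * r + (1 - t) * r by ring.
by rewrite lerD// ler_wpM2l.
Qed.

Lemma bounded_convex_hull (K : numFieldType) (E : normedModType K)
    (A : set E) :
  bounded_family A -> bounded_family (convex_hull A).
Proof.
move=> [[a Aa] /bounded_setP[M AM]].
split; first by exists a; exact: sub_convex_hull.
apply/bounded_setP; exists M => x.
have /convex_hull_min hullM := @convex_closed_ball K E 0 M.
have AM0 : A `<=` [set y | `|0 - y| <= M].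
  by move=> y Ay; rewrite /= sub0r normrN AM.
by move=> /(hullM _ AM0) /=; rewrite sub0r normrN.
Qed.

Lemma compact_closure_net (K : numFieldType) (E : normedModType K)
    (A : set E) (e : K) :
  compact (closure A) -> 0 < e ->
  exists s : seq E, A `<=` [set x | exists2 y, y \in s & ball y e x].
Proof.
move=> + e0; rewrite compact_cover.
move=> /(_ E setT (fun y => (ball y e)^°)) [||D _ Dcov].
- by move=> y _; exact: open_interior.
- by move=> y _; exists y => //; exact: nbhsx_ballx.
exists (finmap.enum_fset D) => x /subset_closure /Dcov [y Dy yx].
by exists y => //; exact: interior_subset yx.
Qed.

(** The norms of the centres of a finite net are summed rather than compared,
    as the order of the scalars need not be total. *)
Lemma compact_closure_bounded (K : numFieldType) (E : normedModType K)
    (A : set E) : compact (closure A) -> bounded_set A.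
Proof.
move=> /compact_closure_net /(_ ltr01) [s As].
apply/bounded_setP; exists (\sum_(y <- s) `|y| + 1) => x /As [y sy].
rewrite -ball_normE /= => yx.
rewrite -[x](subrK y) addrC (le_trans (ler_normD _ _))// lerD//.
  by rewrite (big_rem y sy)/= lerDl sumr_ge0.
by rewrite distrC ltW.
Qed.

(** * Real scalars *)

Lemma of_real_gt0 (R : realType) (s : scalar_kind) (x : R) :
  0 < x -> 0 < of_real s x.
Proof. by case: s => //= x0; rewrite -[0]/((0 : R)%:C%C) ltcR. Qed.

Lemma of_realB1 (R : realType) (s : scalar_kind) (x : R) :
  of_real s (1 - x) = 1 - of_real s x.
Proof. by case: s => //=; rewrite rmorphB rmorph1. Qed.

Lemma of_real_halfX (R : realType) (s : scalar_kind) (n : nat) :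
  of_real s (2^-1 ^+ n : R) = 2^-1 ^+ n.
Proof. by case: s => //=; rewrite rmorphXn /= fmorphV rmorph_nat. Qed.

(** * Invariance under the convex hull *)

Theorem theorem30 (R : realType) (s : scalar_kind)
    (E : completeNormedModType (scalars R s)) (nu : set E -> R)
    (nu_ge0 : forall A : set E, bounded_family A -> 0 <= nu A)
    (nu_mono : forall A B : set E, bounded_family A -> bounded_family B ->
       A `<=` B -> nu A <= nu B)
    (nu_convex : forall (A B : set E) (l : R),
       bounded_family A -> bounded_family B -> 0 <= l -> l <= 1 ->
       nu (minkowski_sum (dilate (of_real s l) A)
                         (dilate (of_real s (1 - l)) B))
         <= l * nu A + (1 - l) * nu B) :
  forall A : set E, A !=set0 -> compact (closure A) ->
    nu (convex_hull A) = nu A.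
Proof.
move=> A A0 cA.
have bA : bounded_family A by split => //; exact: compact_closure_bounded.
have bC := bounded_convex_hull bA.
apply/eqP; rewrite eq_le andbC nu_mono//=; last exact: sub_convex_hull.
have bB : bounded_family [set x : E | `|x| <= 1].
  split; first by exists 0; rewrite /= normr0.
  by apply/bounded_setP; exists 1.
set B := [set x : E | `|x| <= 1] in bB.
have bAB := bounded_minkowski_sum bA bB.
(* Letting [e] tend to 0 concludes. *)
suff H (e : R) : 0 < e -> e <= 1 ->
    nu (convex_hull A) <= (1 - e) * nu A + e * nu (minkowski_sum A B).
  apply/ler_addgt0Pr => d d0.
  pose g := 1 + nu (minkowski_sum A B).
  have g1 : 1 <= g by rewrite lerDl nu_ge0.
  have g0 : 0 < g by rewrite (lt_le_trans _ g1).
  have e0 : 0 < Num.min 1 (d / g) by rewrite lt_min ltr01 divr_gt0.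
  have e1 : Num.min 1 (d / g) <= 1 by rewrite ge_min lexx.
  apply: (le_trans (H _ e0 e1)); set e := Num.min _ _ in e0 e1 *.
  have ed : e * g <= d by rewrite -ler_pdivlMr// ge_min lexx orbT.
  have n0 := nu_ge0 _ bA; rewrite /g in ed.
  nra.
move=> e0 e1.
have ke0 : 0 < of_real s e by exact: of_real_gt0.
(* Radius [e / 2], so that a ball of the net has diameter at most [e]. *)
have [S AS] := compact_closure_net cA (divr_gt0 ke0 (ltr0Sn _ 1)).
pose m : R := 2^-1 ^+ size S.
have m0 : 0 < m by rewrite exprn_gt0// invr_gt0.
have m1 : m <= 1 by rewrite exprn_ile1// ?invr_ge0// invf_le1// ler1n.
(* [N] contains the closed [e]-neighbourhood of [A]: if the distance from [p]
   to [a] is at most [e], then [p] is [e (a + (p - a) / e) + (1 - e) a]. *)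
pose N := minkowski_sum (dilate (of_real s e) (minkowski_sum A B))
                        (dilate (of_real s (1 - e)) A).
have bN : bounded_family N.
  by apply: bounded_minkowski_sum; exact: bounded_dilate.
suff CN : convex_hull A `<=` minkowski_sum (dilate (of_real s m) N)
                       (dilate (of_real s (1 - m)) (convex_hull A)).
  have nuN : nu N <= e * nu (minkowski_sum A B) + (1 - e) * nu A.
    by apply: nu_convex => //; exact: ltW.
  have := nu_convex N _ m bN bC (ltW m0) m1.
  have := nu_mono _ _ bC (bounded_minkowski_sum (bounded_dilate (of_real s m) bN)
    (bounded_dilate (of_real s (1 - m)) bC)) CN.
  move=> /le_trans /[apply] h.
  (* The term in [nu (convex_hull A)] is absorbed in the left-hand side. *)
  have : m * nu (convex_hull A) <= m * nu N by lra.
  by rewrite ler_pM2l//; lra.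
move=> c /(convex_hull_cover AS) [y [p [q [Sy Ap Aq ->]]]].
rewrite of_realB1 of_real_halfX.
exists (2^-1 ^+ size S *: p).
  exists p => //.
  (* [p] and any point [a] of [A] in the ball are both within [e / 2] of the
     centre [y]. *)
  have [A1|/set0P[a [Aa ya]]] := eqVneq (A `&` ball y (of_real s e / 2)) set0.
    suff : (set0 : set E) p by [].
    by apply: convex_hull_min Ap; [apply/convex_setP|rewrite A1].
  have yp : `|y - p| <= of_real s e / 2.
    apply: (convex_hull_min (@convex_closed_ball _ _ y _)) Ap => x [_].
    by rewrite -ball_normE /= => /ltW.
  have ap : `|p - a| <= of_real s e.
    rewrite -(subrK y p) -addrA (le_trans (ler_normD _ _))//.
    rewrite [leRHS]splitr lerD// 1?distrC//.
    by move: ya; rewrite -ball_normE /= distrC => /ltW.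
  have keN0 : of_real s e != 0 by rewrite gt_eqF.
  exists (of_real s e *: (a + (of_real s e)^-1 *: (p - a))).
    exists (a + (of_real s e)^-1 *: (p - a)) => //.
    exists a => //; exists ((of_real s e)^-1 *: (p - a)) => //.
    rewrite /B/= normrZ gtr0_norm ?invr_gt0// mulrC ler_pdivrMr// mul1r //.
  exists ((1 - of_real s e) *: a); first by rewrite of_realB1; exists a.
  rewrite scalerDr scalerA divff// scale1r scalerBl scale1r.
  by rewrite addrAC (addrC (_ *: a)) subrK addrC subrK.
by exists ((1 - 2^-1 ^+ size S) *: q) => //; exists q.
Qed.
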